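(* Let $\mathcal{A}$ be a complex Banach algebra with unity, $a,b\in\mathcal{A}$ and $k$ a positive integer. Suppose $ab\alpha_{1}\alpha_{2}\cdots\alpha_{k}=0$ for all $\alpha_{1},\dots,\alpha_{k}\in\{a,b\}$. Then $a$ and $b$ are both g$\pi$-Hirano invertible if and only if $a+b$ is g$\pi$-Hirano invertible.
   Context: $\mathcal{A}^{qnil}$ denotes the set of quasinilpotent elements of $\mathcal{A}$ (spectrum equal to $\{0\}$). An element $a\in\mathcal{A}$ is g$\pi$-Hirano invertible if there exists $x\in\mathcal{A}$ with $xax=x$, $ax=xa$ and $a-a^{n+2}x\in\mathcal{A}^{qnil}$ for some positive integer $n$. *)

(* Defs.v *)
From HB Require Import structures.
From mathcomp Require Import all_boot all_order all_algebra.
From mathcomp Require Import reals complex.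
Set Implicit Arguments. Unset Strict Implicit. Unset Printing Implicit Defensive.
Import Order.TTheory GRing.Theory Num.Theory.
Local Open Scope ring_scope.

(* A complex Banach algebra with unity: a unital C-algebra A (MathComp
   unitAlgType, so [x \is a GRing.unit] is genuine two-sided invertibility)
   together with a norm A -> R which is a vector-space norm, is
   submultiplicative, and makes A complete (Cauchy sequences converge). *)
Record banach_norm (R : realType) (A : unitAlgType R[i]) := BanachNorm {
  bnorm : A -> R;
  bnorm_ge0 : forall x, 0 <= bnorm x;
  bnorm_eq0 : forall x, bnorm x = 0 -> x = 0;
  bnormD : forall x y, bnorm (x + y) <= bnorm x + bnorm y;
  bnormZ : forall (c : R[i]) x, bnorm (c *: x) = ComplexField.Normc.normc c * bnorm x;
  bnormM : forall x y, bnorm (x * y) <= bnorm x * bnorm y;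
  bnorm_complete : forall u : nat -> A,
    (forall e : R, 0 < e -> exists N : nat, forall m n : nat,
        (N <= m)%N -> (N <= n)%N -> bnorm (u m - u n) < e) ->
    exists l : A, forall e : R, 0 < e -> exists N : nat, forall n : nat,
        (N <= n)%N -> bnorm (u n - l) < e
}.

Definition spectrum (R : realType) (A : unitAlgType R[i]) (a : A) : pred R[i] :=
  fun l => ~~ ((l%:A - a) \is a GRing.unit).

Definition quasinilpotent (R : realType) (A : unitAlgType R[i]) (a : A) : Prop :=
  forall l : R[i], spectrum a l <-> l = 0.

Definition gpi_Hirano_invertible (R : realType) (A : unitAlgType R[i]) (a : A) : Prop :=
  exists x : A, [/\ x * a * x = x, a * x = x * a &
    exists n : nat, (0 < n)%N /\ quasinilpotent (a - a ^+ (n + 2) * x)].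

(* Main.v *)
Require Import Defs.
From HB Require Import structures.
From mathcomp Require Import all_boot all_order all_algebra.
From mathcomp Require Import reals complex.
From mathcomp Require Import classical_sets topology normedtype.
From mathcomp Require Import ring lra.
Import Order.TTheory GRing.Theory Num.Theory.
Local Open Scope ring_scope.

(* An element is gpi-Hirano invertible iff a - a^(n+1) is quasinilpotent for
   some n > 0: one direction is algebra, the other lifts c = a^n, for which
   c - c^2 is quasinilpotent, to an idempotent. Put s = a + b,
   p = s - s^(l+1), u = a - a^(l+1), v = b - b^(l+1), and let t be such that
   a b w t = 0 for every word w in a, b (for instance t = s^k). Then
   a p^n t = a u^n t, and p t = v t + W a t for a fixed polynomial W in a, b,
   whence p^n t = v^n t + sum v^i W a u^(n-1-i) t: the powers of p decay
   faster than any geometric sequence if those of u and v do. Conversely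
   u^n a^(k+1) = a p^n a^k and v^n b^(k+1) = p^n b^(k+1).

   That a quasinilpotent y satisfies |y^n|^(1/n) -> 0 is obtained without
   complex analysis: the functions
   H_m(z) = (1 - (z y)^(2^m))^-1 are averages of rotates of the resolvent
   H_0, so they share its Lipschitz constant on every disc, and smallness of
   (r y)^(2^m) for large m propagates from r to r + delta with delta fixed. *)

(** * Compactness of squares in the real plane *)

Section LocallyBounded.
Local Open Scope classical_set_scope.
Import numFieldNormedType.Exports.

(** Compactness of the square in filter form: [M] tends to +oo, and the bounds valid near each point
    for large [M] merge into a single one. It will be applied to functions of a complex variable
    through real and imaginary parts. *)
Lemma locally_bounded_square (R : realType) (f : R -> R -> R) (r : R) :
  (forall x y, exists2 d : R, 0 < d & exists M : R, forall x' y',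
     `|x - x'| < d -> `|y - y'| < d -> f x' y' <= M) ->
  exists M : R, forall x y, `|x| <= r -> `|y| <= r -> f x y <= M.
Proof.
move=> locf.
have K : compact (`[- r, r]%classic `*` `[- r, r]%classic : set (R * R)).
  by apply: compact_setX; exact: segment_compact.
move/compact_near_coveringP: K => /(_ R +oo%R (fun M z => f z.1 z.2 <= M) _).
case=> [|M [_ HM]].
  move=> [x y] _ /=; have [d d0 [M HM]] := locf x y.
  exists ([set z | `|x - z.1| < d /\ `|y - z.2| < d], [set M' | M <= M']) => /=.
    split; last by apply: nbhs_pinfty_ge; exact: num_real.
    exists (ball x d, ball y d); first by split; apply: nbhsx_ballx.
    by move=> z.
  by move=> [z M'] /= [[z1 z2] MM']; apply: le_trans (HM _ _ z1 z2) MM'.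
exists (M + 1) => x y xr yr.
apply: (HM (M + 1) _ (x, y)); first by rewrite ltrDl.
by split => /=; rewrite in_itv /= -ler_norml.
Qed.
End LocallyBounded.

(** * Norms and limits *)

Section BanachNorm.
Set Implicit Arguments.
Unset Strict Implicit.
Unset Printing Implicit Defensive.
Variables (R : realType) (A : unitAlgType R[i]) (N : banach_norm A).
Implicit Types (x y z u v : A) (r e : R).
Local Notation nrm := (bnorm N).
Local Notation normc := Normc.normc.

Lemma bnorm0 : nrm 0 = 0.
Proof. by rewrite -(scale0r (0 : A)) bnormZ Normc.normc0 mul0r. Qed.

Lemma bnormN x : nrm (- x) = nrm x.
Proof.
by rewrite -scaleN1r bnormZ normcN Normc.normc1 mul1r.
Qed.

Lemma bnormBC x y : nrm (x - y) = nrm (y - x).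
Proof. by rewrite -bnormN opprB. Qed.

Lemma bnormB x y : nrm (x - y) <= nrm x + nrm y.
Proof. by rewrite -(bnormN y) bnormD. Qed.

Lemma bnormM_le x y r e : nrm x <= r -> nrm y <= e -> nrm (x * y) <= r * e.
Proof.
move=> xr ye; apply: le_trans (bnormM N _ _) _.
by apply: ler_pM => //; exact: bnorm_ge0.
Qed.

Lemma bnorm1_gt0 : 0 < nrm 1.
Proof.
rewrite lt_neqAle bnorm_ge0 andbT eq_sym; apply/eqP => /bnorm_eq0/eqP.
by rewrite oner_eq0.
Qed.

Lemma bnormX x n : nrm (x ^+ n) <= nrm 1 * nrm x ^+ n.
Proof.
elim: n => [|n IH]; first by rewrite !expr0 mulr1.
by rewrite exprS exprS mulrCA; apply: bnormM_le.
Qed.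

Lemma bnorm_small x : (forall e, 0 < e -> nrm x <= e) -> x = 0.
Proof.
move=> H; apply: (bnorm_eq0 (b := N)); apply/eqP.
rewrite eq_le bnorm_ge0 andbT; apply/ler_addgt0Pl => e e0.
by rewrite addr0 H.
Qed.

Definition bconverges (u : nat -> A) x := forall e, 0 < e ->
  exists n0 : nat, forall n, (n0 <= n)%N -> nrm (u n - x) < e.

Lemma half_exp_ge0 n : 0 <= 2^-1 ^+ n :> R.
Proof. by rewrite exprn_ge0 // invr_ge0. Qed.

Lemma half_exp_small r e : 0 < e -> exists n0 : nat, forall n, (n0 <= n)%N ->
  r * 2^-1 ^+ n < e.
Proof.
move=> e0; set K := Num.max r 1; have K1 : 0 < K by rewrite lt_max ltr01 orbT.
have [n0 Hn0] : exists n0 : nat, K / e < n0%:R.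
  by exists (Num.bound (K / e)); apply: archi_boundP; rewrite divr_ge0 // ltW.
exists n0 => n n0n; apply: (@le_lt_trans _ _ (K * 2^-1 ^+ n)).
  by rewrite ler_wpM2r ?half_exp_ge0 // /K le_max lexx.
rewrite exprVn ltr_pdivrMr ?exprn_gt0 //.
rewrite mulrC -ltr_pdivrMr //; apply: lt_le_trans Hn0 _.
rewrite -natrX ler_nat; apply: leq_trans n0n _; exact/ltnW/ltn_expl.
Qed.

Lemma geometric_converges (u : nat -> A) r :
  (forall n, nrm (u n.+1 - u n) <= r * 2^-1 ^+ n) -> exists x, bconverges u x.
Proof.
move=> H; have r0 : 0 <= r by have := H 0%N; rewrite mulr1; apply: le_trans; exact: bnorm_ge0.
(* The exact partial geometric sum is kept, since a bound by [r * 2 * 2^-1 ^+ n] alone would not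
   pass through the induction on [d]. *)
have tail n d : nrm (u (n + d)%N - u n) <= r * 2 * (2^-1 ^+ n - 2^-1 ^+ (n + d)).
  elim: d => [|d IH]; first by rewrite addn0 !subrr bnorm0 mulr0.
  rewrite addnS -(subrK (u (n + d)%N) (u _.+1)) -addrA.
  apply: le_trans (bnormD N _ _) _; apply: le_trans (lerD (H _) IH) _.
  by rewrite exprS; lra.
apply: (bnorm_complete (u := u)) => e e0.
have [n0 Hn0] := half_exp_small (r * 4) e0.
have key m : (n0 <= m)%N -> nrm (u m - u n0) < e / 2.
  move=> n0m; have := tail n0 (m - n0)%N; rewrite subnKC // => /le_lt_trans; apply.
  have := Hn0 n0 (leqnn _); have : 0 <= r * 2^-1 ^+ m by rewrite mulr_ge0 ?half_exp_ge0.
  by rewrite mulrBr; lra.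
exists n0 => m n hm hn; rewrite -(subrK (u n0) (u m)) -addrA.
apply: le_lt_trans (bnormD N _ _) _; rewrite (bnormBC (u n0)).
by have := key _ hm; have := key _ hn; lra.
Qed.

Lemma bconverges_uniq (u : nat -> A) x y :
  bconverges u x -> bconverges u y -> x = y.
Proof.
move=> ux uy; apply/eqP; rewrite -subr_eq0; apply/eqP/bnorm_small => e e0.
have e2 : 0 < e / 2 by rewrite divr_gt0.
have [n1 H1] := ux _ e2.
have [n2 H2] := uy _ e2.
have := H1 _ (leq_maxl n1 n2); have := H2 _ (leq_maxr n1 n2).
set w := u _ => h1 h2; have -> : x - y = (w - y) - (w - x) by rewrite opprB [RHS]addrC subrKA.
by apply: le_trans (bnormB _ _) _; lra.
Qed.

Lemma bconvergesM (u v : nat -> A) x y :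
  bconverges u x -> bconverges v y -> bconverges (fun n => u n * v n) (x * y).
Proof.
move=> ux vy e e0.
set K := 1 + nrm x + nrm y.
have [x0 y0] : 0 <= nrm x /\ 0 <= nrm y by split; exact: bnorm_ge0.
have K1 : 1 <= K by rewrite /K; lra.
set d := Num.min 1 (e / (2 * K)).
have d0 : 0 < d by rewrite lt_min ltr01 divr_gt0 //; lra.
have [n1 H1] := ux d d0; have [n2 H2] := vy d d0.
exists (maxn n1 n2) => n; rewrite geq_max => /andP[/H1 h1 /H2 h2].
have dK : d * (2 * K) <= e by rewrite -ler_pdivlMr ?ge_min ?lexx ?orbT //; lra.
have d1 : d <= 1 by rewrite ge_min lexx.
have -> : u n * v n - x * y = (u n - x) * ((v n - y) + y) + x * (v n - y).
  by rewrite subrK mulrBl mulrBr subrKA.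
apply: le_lt_trans (bnormD N _ _) _.
have l1 : nrm ((u n - x) * ((v n - y) + y)) <= d * (1 + nrm y).
  apply: bnormM_le; first exact: ltW.
  apply: le_trans (bnormD N _ _) _; lra.
have l2 : nrm (x * (v n - y)) <= nrm x * d by apply: bnormM_le => //; exact: ltW.
rewrite /K in dK; nra.
Qed.

Lemma bconvergesD (u v : nat -> A) x y :
  bconverges u x -> bconverges v y -> bconverges (fun n => u n + v n) (x + y).
Proof.
move=> ux vy e e0; have e2 : 0 < e / 2 by rewrite divr_gt0.
have [n1 H1] := ux _ e2.
have [n2 H2] := vy _ e2.
exists (maxn n1 n2) => n; rewrite geq_max => /andP[/H1 h1 /H2 h2].
by rewrite opprD addrACA; apply: le_lt_trans (bnormD N _ _) _; lra.
Qed.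

Lemma bconverges_cst x : bconverges (fun=> x) x.
Proof. by move=> e e0; exists 0%N => n _; rewrite subrr bnorm0. Qed.

Lemma bconverges_shift (u : nat -> A) x :
  bconverges u x -> bconverges (fun n => u n.+1) x.
Proof. by move=> ux e /ux[n0 H]; exists n0 => n /leqW/H. Qed.

Lemma bconverges_comm (u : nat -> A) x y :
  bconverges u x -> (forall n, GRing.comm y (u n)) -> GRing.comm y x.
Proof.
move=> ux cu; have c := bconverges_cst y.
apply: bconverges_uniq (bconvergesM c ux) _.
by move=> e /(bconvergesM ux c)[n0 H]; exists n0 => n /H; rewrite cu.
Qed.
End BanachNorm.

(** * Topologically nilpotent elements and lifting of idempotents *)

Section TopologicallyNilpotent.
Set Implicit Arguments.
Unset Strict Implicit.
Unset Printing Implicit Defensive.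
Variables (R : realType) (A : unitAlgType R[i]) (N : banach_norm A).
Implicit Types (c d q t x y z w : A) (r e : R).
Local Notation nrm := (bnorm N).

(** Spectral radius zero, |y^n|^(1/n) -> 0, in a form free of roots; [C] may depend on the rate
    [e]. *)
Definition topnil y := forall e, 0 < e ->
  exists C : R, forall n, nrm (y ^+ n) <= C * e ^+ n.

Lemma exp_bound_initial (f : nat -> R) e j : 0 < e -> (forall n, 0 <= f n) ->
  exists2 C : R, 0 <= C & forall n, (n < j)%N -> f n <= C * e ^+ n.
Proof.
move=> e0 f0; have g0 i : 0 <= f i / e ^+ i by rewrite divr_ge0 // exprn_ge0 // ltW.
exists (\sum_(i < j) f i / e ^+ i); first exact: sumr_ge0.
move=> n nj; rewrite -ler_pdivrMr ?exprn_gt0 //.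
rewrite (bigD1 (Ordinal nj)) //= lerDl; exact: sumr_ge0.
Qed.

Lemma exp_bound_eventually (f : nat -> R) e j C : 0 < e -> (forall n, 0 <= f n) ->
  (forall n, f (n + j)%N <= C * e ^+ n) ->
  exists C' : R, forall n, f n <= C' * e ^+ n.
Proof.
move=> e0 f0 H; have [C1 C10 H1] := exp_bound_initial j e0 f0.
have C0 : 0 <= C by have := H 0%N; rewrite mulr1; apply: le_trans.
have ej : 0 < e ^+ j by rewrite exprn_gt0.
exists (C1 + C / e ^+ j) => n; have en : 0 <= e ^+ n by rewrite exprn_ge0 // ltW.
case: (ltnP n j) => [nj|jn]; rewrite mulrDl.
  by rewrite (le_trans (H1 _ nj)) // lerDl mulr_ge0 // divr_ge0 // ltW.
rewrite -{1}(subnK jn) (le_trans (H _)) //.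
rewrite -[X in _ <= _ + _ * e ^+ X](subnK jn) exprD [_ * (_ * e ^+ j)]mulrACA mulVf ?gt_eqF //.
by rewrite mulr1 lerDr mulr_ge0.
Qed.

Lemma bnormXM_le x z r n : nrm x <= r -> nrm (x ^+ n * z) <= r ^+ n * nrm z.
Proof.
move=> xr; elim: n => [|n IH]; first by rewrite !expr0 !mul1r.
by rewrite !exprS -!mulrA; apply: bnormM_le.
Qed.

(** Euclidean division of [m] by [n]: the multiple of [n] costs no constant, and only finitely many
    remainders are left for [C]. *)
Lemma power_bound y e n : 0 < e -> (0 < n)%N -> nrm (y ^+ n) <= e ^+ n ->
  exists C : R, forall m, nrm (y ^+ m) <= C * e ^+ m.
Proof.
move=> e0 n0 H.
have [C C0 HC] := exp_bound_initial n e0 (fun i => bnorm_ge0 N (y ^+ i)).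
exists C => m; rewrite (divn_eq m n) mulnC !exprD !exprM.
apply: le_trans (bnormXM_le _ _ H) _; rewrite mulrCA.
rewrite ler_wpM2l ?exprn_ge0 ?(ltW e0) ?HC ?ltn_pmod // ltW.
Qed.

Lemma topnilM y c : topnil y -> GRing.comm y c -> topnil (y * c).
Proof.
(* The added 1 keeps [r] positive when [c] is 0; the rate [e / r] for [y] compensates the growth of
   c^n. *)
move=> ty yc e e0; set r := nrm c + 1.
have r0 : 0 < r by rewrite ltr_wpDl ?bnorm_ge0.
have [C HC] := ty (e / r) (divr_gt0 e0 r0).
exists (C * nrm 1) => n; rewrite exprMn_comm //.
apply: le_trans (bnormM_le (HC n) (bnormX N c n)) _.
have C0 : 0 <= C by have := HC 0%N; rewrite mulr1; apply: le_trans; exact: bnorm_ge0.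
rewrite -mulrA -[X in _ <= X]mulrA ler_wpM2l // mulrCA ler_wpM2l ?bnorm_ge0 //.
have -> : e ^+ n = (e / r) ^+ n * r ^+ n by rewrite -exprMn divfK ?gt_eqF.
rewrite ler_wpM2l ?exprn_ge0 ?divr_ge0 ?(ltW e0) ?(ltW r0) //.
by rewrite lerXn2r ?nnegrE ?bnorm_ge0 ?(ltW r0) // lerDl.
Qed.

Lemma comm_scalar y (l : R[i]) : GRing.comm y l%:A.
Proof. by rewrite /GRing.comm mulr_algl mulr_algr. Qed.

Lemma topnilZ y (l : R[i]) : topnil y -> topnil (l *: y).
Proof. by move=> ty; rewrite -mulr_algr; apply: topnilM (comm_scalar _ _). Qed.

(** Neumann series, converging with ratio 1/2. *)
Lemma topnil_unit w : topnil w -> 1 - w \is a GRing.unit.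
Proof.
move=> tw; have [|C HC] := tw 2^-1; first by rewrite invr_gt0.
pose S n := \sum_(i < n) w ^+ i.
have [l Sl] : exists l, bconverges N S l.
  by apply: (geometric_converges (r := C)) => n; rewrite /S big_ord_recr /= addrAC subrr add0r.
have wl : GRing.comm w l.
  by apply: (bconverges_comm Sl) => n; apply: commr_sum => i _; apply: commrX.
have lr : (1 - w) * l = 1.
  apply: (bconverges_uniq (bconvergesM (bconverges_cst N (1 - w)) Sl)) => e e0.
  have [n0 H] := half_exp_small C e0; exists n0 => n /H; apply: le_lt_trans.
  have -> : (1 - w) * S n - 1 = - w ^+ n.
    by rewrite -(opprB w) mulNr -subrX1 opprB addrAC subrr sub0r.
  by rewrite bnormN HC.
apply/unitrP; exists l; split => //.
by rewrite -[RHS]lr mulrBl mulrBr mulr1 mul1r wl.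
Qed.

Lemma topnil_quasinilpotent y : topnil y -> quasinilpotent y.
Proof.
move=> ty l; rewrite /spectrum; split=> [nu|->].
  apply/eqP; apply: contraNT nu => l0.
  have -> : l%:A - y = l *: (1 - l^-1 *: y) by rewrite scalerBr scalerA divff // scale1r.
  by rewrite scaler_unit ?unitfE // topnil_unit //; apply: topnilZ.
(* An inverse of [y] would give |1| <= |y^n| |y^-n| <= C |1| 2^-n for every n. *)
rewrite scale0r sub0r unitrN; apply/negP => uy.
have V0 : 0 < nrm y^-1.
  rewrite lt_neqAle bnorm_ge0 andbT eq_sym; apply/eqP => /bnorm_eq0 V.
  by have := divrr uy; rewrite V mulr0 => /esym/eqP; rewrite oner_eq0.
have e0 : 0 < (2 * nrm y^-1)^-1 by rewrite invr_gt0 mulr_gt0.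
have [C HC] := ty _ e0.
have [n0 Hn] := half_exp_small (C * nrm 1) (bnorm1_gt0 N).
have := bnormM_le (HC n0) (bnormX N y^-1 n0).
rewrite -exprMn_comm ?divrr //; last by rewrite /GRing.comm mulrV // mulVr.
rewrite expr1n mulrACA -exprMn.
have -> : (2 * nrm y^-1)^-1 * nrm y^-1 = 2^-1 by rewrite invfM -mulrA mulVf ?gt_eqF // mulr1.
by move=> h; have := Hn _ (leqnn _); rewrite ltNge h.
Qed.

(* x = f(t) and r = f(e) for a polynomial f with coefficients in nat, so that
   a bound |t^n| <= C e^n gives |x| <= C r. *)
Inductive dominated t e : A -> R -> Prop :=
| dominated0 : dominated t e 0 0
| dominatedXD n x r :
    dominated t e x r -> dominated t e (t ^+ n + x) (e ^+ n + r).

Lemma dominatedX t e n : dominated t e (t ^+ n) (e ^+ n).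
Proof.
by rewrite -[t ^+ n]addr0 -[e ^+ n]addr0; apply: dominatedXD; apply: dominated0.
Qed.

Lemma dominatedD t e x y r s :
  dominated t e x r -> dominated t e y s -> dominated t e (x + y) (r + s).
Proof.
elim=> [|n x' r' _ IH] ys; first by rewrite !add0r.
by rewrite -!addrA; apply: dominatedXD; apply: IH.
Qed.

Lemma dominatedM t e x y r s :
  dominated t e x r -> dominated t e y s -> dominated t e (x * y) (r * s).
Proof.
move=> + ys; elim=> [|n x' r' _ IH]; first by rewrite !mul0r; exact: dominated0.
rewrite !mulrDl; apply: dominatedD IH.
elim: ys => [|m y' s' _ IH]; first by rewrite !mulr0; exact: dominated0.
by rewrite !mulrDr -!exprD; apply: dominatedXD.
Qed.

Lemma dominated_bnorm t e C x r : (forall n, nrm (t ^+ n) <= C * e ^+ n) ->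
  dominated t e x r -> nrm x <= C * r.
Proof.
move=> H; elim=> [|n x' r' _ IH]; first by rewrite bnorm0 mulr0.
by rewrite mulrDr; apply: le_trans (bnormD N _ _) _; apply: lerD.
Qed.

Lemma dominated_comm t e x r z :
  GRing.comm z t -> dominated t e x r -> GRing.comm z x.
Proof.
move=> zt; elim=> [|n x' r' _ IH]; first exact: commr0.
by apply: commrD => //; apply: commrX.
Qed.

(** Fixed-point iteration for c = 1 + t c^2, solved formally by the generating function of the
    Catalan numbers. The ring is a parameter because the iteration runs both in [A] and on a real
    majorant. *)
Fixpoint catalan_iter (B : nzRingType) (t : B) n : B :=
  if n is m.+1 then 1 + t * (catalan_iter t m * catalan_iter t m) else 0.

Lemma catalan_iter_step (B : nzRingType) (t : B) n :
  GRing.comm (catalan_iter t n) (catalan_iter t n.+1) ->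
  catalan_iter t n.+2 - catalan_iter t n.+1 =
  t * ((catalan_iter t n.+1 - catalan_iter t n) * (catalan_iter t n.+1 + catalan_iter t n)).
Proof.
set u := catalan_iter t n; set v := catalan_iter t n.+1 => uv.
transitivity (1 + t * (v * v) - (1 + t * (u * u))) => //.
clearbody u v.
rewrite addrAC opprD addNKr addrC -mulrBr; congr (_ * _).
by rewrite mulrBl !mulrDr uv opprD addrA addrK.
Qed.

(** The real iteration at [e] majorises the one at [t] in the sense of [dominated], successive
    differences included, so its geometric convergence carries over to [A]. *)
Lemma catalan_equation t : topnil t -> exists c, c = 1 + t * (c * c) /\
  forall z, GRing.comm z t -> GRing.comm z c.
Proof.
(* With 1/8 the real iterates stay in [0, 2], so each difference is at most 4/8 = 1/2 of the
   previous one. *)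
move=> tt; pose e : R := 8^-1.
have e0 : 0 < e by rewrite invr_gt0.
have [C HC] := tt e e0.
pose u := catalan_iter t; pose g := catalan_iter e.
have ug n : dominated t e (u n) (g n).
  elim: n => [|n IH]; first exact: dominated0.
  apply: dominatedD; first exact: (dominatedX t e 0).
  by apply: dominatedM; [exact: (dominatedX t e 1)|exact: dominatedM].
have cu z n : GRing.comm z t -> GRing.comm z (u n).
  by move=> zt; apply: dominated_comm zt (ug n).
have cuu n m : GRing.comm (u n) (u m).
  by apply: (cu); apply/commr_sym; apply: (cu).
have dug n : dominated t e (u n.+1 - u n) (g n.+1 - g n).
  elim: n => [|n IH].
    by rewrite /u /g /= !mul0r !mulr0 !addr0 !subr0; exact: (dominatedX t e 0).
  rewrite /u (catalan_iter_step (cuu n n.+1)) (catalan_iter_step (mulrC _ _ : GRing.comm (g n) (g n.+1))).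
  apply: dominatedM; first exact: (dominatedX t e 1).
  by apply: dominatedM => //; apply: dominatedD.
have gb n : 0 <= g n <= 2.
  elim: n => [|n]; first by rewrite lexx ler0n.
  by rewrite /g /= -/(g n) /e => /andP[g0 g2]; apply/andP; split; nra.
have dg n : 0 <= g n.+1 - g n <= 2^-1 ^+ n.
  elim: n => [|n]; first by rewrite /g /= !mul0r !mulr0 !addr0 !subr0 ler01 lexx.
  rewrite [X in _ -> _ <= X <= _]catalan_iter_step; last exact: mulrC.
  rewrite -!/(g _) exprS /e => /andP[d0 d1].
  have /andP[h1 h2] := gb n; have /andP[h3 h4] := gb n.+1.
  set d := g n.+1 - g n in d0 d1 *; set s := g n.+1 + g n.
  have s0 : 0 <= s by rewrite addr_ge0.
  have s4 : s <= 4 by rewrite /s; lra.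
  apply/andP; split; first by rewrite !mulr_ge0 // invr_ge0.
  nra.
have C0 : 0 <= C by have := HC 0%N; rewrite mulr1; apply: le_trans; exact: bnorm_ge0.
have [c uc] : exists c, bconverges N u c.
  apply: (geometric_converges (r := C)) => n.
  apply: le_trans (dominated_bnorm HC (dug n)) _.
  by have /andP[_ h] := dg n; apply: ler_wpM2l.
exists c; split; last by move=> z zt; apply: (bconverges_comm uc) => n; apply: (cu).
apply: (bconverges_uniq (bconverges_shift uc)).
apply: bconvergesD (bconverges_cst N 1) _.
exact: bconvergesM (bconverges_cst N t) (bconvergesM uc uc).
Qed.

(* With C = 1 + t C^2 and q = t C one has q - q^2 = t = c - c^2, hence
   (1 - 2c)^2 = (1 - 2q)^2 and (1 - 2c)/(1 - 2q) = 1 - 2e defines e. *)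
Lemma lift_idempotent c : topnil (c - c * c) -> exists e d : A,
  [/\ e * e = e, c - e = (c - c * c) * d &
   forall z, GRing.comm z c -> GRing.comm z e /\ GRing.comm z d].
Proof.
set t := c - c * c => tt; have [C [HC cC]] := catalan_equation tt.
have ct z : GRing.comm z c -> GRing.comm z t.
  by move=> zc; apply: commrB => //; apply: commrM.
have {}cC z : GRing.comm z c -> GRing.comm z C by move=> /ct/cC.
pose q := t * C.
have cq z : GRing.comm z c -> GRing.comm z q.
  by move=> zc; apply: commrM; [exact: ct|exact: cC].
have cc : GRing.comm c c by [].
have qc : GRing.comm q c by apply/commr_sym/cq.
have tC : GRing.comm t C by apply/cC/commr_sym/ct.
have qq : q - q * q = t.
  apply/eqP; rewrite subr_eq; apply/eqP; rewrite {1}/q {1}HC mulrDr mulr1; congr (_ + _).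
  by rewrite /q -mulrA (mulrA C) -tC !mulrA.
pose v := 1 - (q + q).
have uv : v \is a GRing.unit.
  apply: topnil_unit; rewrite -[q]mulr1 -mulrDr.
  have -> : t * C * (1 + 1) = t * (C * (1 + 1)) by rewrite mulrA.
  by apply: topnilM => //; apply: commrM => //; apply: commrD; apply: commr1.
have cv z : GRing.comm z c -> GRing.comm z v^-1.
  by move=> zc; apply: commrV; apply: commrB (commr1 _) _; apply: commrD; exact: cq.
(* (c - q)(1 - c - q) = (c - c^2) - (q - q^2) = 0, which makes (c - q) / v idempotent. *)
have key : (c - q) * (c - q) = (c - q) * v.
  apply/esym/eqP; rewrite -subr_eq0 -mulrBr.
  have -> : v - (c - q) = 1 - (c + q) by rewrite /v -addrA -opprD addrC (addrC (q + q)) addrA subrK addrC.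
  have -> : (c - q) * (1 - (c + q)) = c - q - (c * c - q * q).
    by rewrite mulrBr mulr1; congr (_ - _); rewrite mulrBl !mulrDr qc opprD addrA addrK.
  by rewrite [- (c * c - _)]opprD opprK addrACA -/t (addrC (- q)) -(opprB q) qq subrr.
have vc : GRing.comm v^-1 (c - q).
  by apply: commrB; apply/commr_sym; apply: cv => //; exact/commr_sym.
exists ((c - q) * v^-1), (C * (1 - (c + c)) * v^-1); split.
- by rewrite -mulrA (mulrA v^-1) vc !mulrA key mulrK.
- rewrite !mulrA -/q; apply: (mulIr uv); rewrite mulrBl !mulrVK //.
  by rewrite /v !mulrBr !mulrDr !mulr1 qc addrAC subKr.
- move=> z zc; split.
    by apply: commrM; [apply: commrB => //; exact: cq|exact: cv].
  apply: commrM (cv _ zc); apply: commrM; first exact: cC.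
  by apply: commrB; [exact: commr1|apply: commrD].
Qed.
End TopologicallyNilpotent.

(** * The spectral radius formula for quasinilpotent elements *)

Section Quasinilpotent.
Set Implicit Arguments.
Unset Strict Implicit.
Unset Printing Implicit Defensive.
Variables (R : realType) (A : unitAlgType R[i]) (N : banach_norm A).
Implicit Types (u v w x y : A) (z : R[i]) (r e : R).
Local Notation nrm := (bnorm N).
Local Notation normc := (@Normc.normc R).

Lemma normc_le_Re_Im z : normc z <= `|complex.Re z| + `|complex.Im z|.
Proof.
case: z => p q /=; rewrite -[X in _ <= X]ger0_norm ?addr_ge0 // -sqrtr_sqr.
rewrite ler_sqrt ?sqr_ge0 // sqrrD !real_normK ?num_real //.
by rewrite lerD2r lerDl mulrn_wge0 // mulr_ge0.
Qed.

Lemma Re_Im_le_normc z : `|complex.Re z| <= normc z /\ `|complex.Im z| <= normc z.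
Proof.
case: z => p q /=; rewrite -!sqrtr_sqr; split; rewrite ler_sqrt ?addr_ge0 ?sqr_ge0 //.
  by rewrite lerDl sqr_ge0.
by rewrite lerDr sqr_ge0.
Qed.

Lemma normc_ge0 z : 0 <= normc z.
Proof. by case: z => p q; exact: sqrtr_ge0. Qed.

Lemma normc_half : normc 2^-1 = 2^-1.
Proof.
rewrite Normc.normcV; congr (_^-1).
by rewrite -[2]/(1 *+ 2 : R[i]) normcMn Normc.normc1.
Qed.

Lemma normcX z n : normc (z ^+ n) = normc z ^+ n.
Proof.
elim: n => [|n IH]; first by rewrite !expr0 Normc.normc1.
by rewrite !exprS Normc.normcM IH.
Qed.

Lemma invrB u v : u \is a GRing.unit -> v \is a GRing.unit ->
  u^-1 - v^-1 = u^-1 * (v - u) * v^-1.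
Proof. by move=> uu uv; rewrite mulrBr mulVr // mulrBl mulrK // mul1r. Qed.

(** The variable is the inverse of the spectral parameter, so that for a quasinilpotent [y] the
    inverse exists on the whole plane. *)
Definition resolvent y z := (1 - z *: y)^-1.

(** * The resolvent and its dyadic averages *)

Section EntireResolvent.
Variable y : A.
Hypothesis unitB : forall z, 1 - z *: y \is a GRing.unit.

Lemma resolventB z z' :
  resolvent y z - resolvent y z' = (z - z') *: (resolvent y z * y * resolvent y z').
Proof.
rewrite /resolvent invrB // opprB [1 - _ + _]addrC addrA subrK -scalerBl.
by rewrite -scalerAr -scalerAl.
Qed.

(** By the resolvent identity |H(z')| <= |H(z)| + |z' - z| |H(z')| |y| |H(z)|. For z' close to z the
    last term is at most |H(z')| / 2, hence |H(z')| <= 2 |H(z)|, and compactness applies. *)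
Lemma resolvent_bounded r : exists M, forall z, normc z <= r -> nrm (resolvent y z) <= M.
Proof.
have [p q|M HM] := @locally_bounded_square R (fun p q => nrm (resolvent y (p +i* q)%C)) r.
  set F := nrm (resolvent y (p +i* q)%C); set K := nrm y * F.
  have K0 : 0 <= K by rewrite mulr_ge0 ?bnorm_ge0.
  exists (4 * (K + 1))^-1; first by rewrite invr_gt0; lra.
  exists (2 * F) => p' q' hp hq.
  set G := nrm _.
  have h1 : G <= F + normc ((p' +i* q')%C - (p +i* q)%C) * (G * K).
    rewrite {1}/G -[resolvent y (p' +i* q')%C](subrK (resolvent y (p +i* q)%C)) addrC.
    apply: le_trans (bnormD N _ _) _; rewrite lerD2l resolventB bnormZ.
    rewrite ler_wpM2l ?normc_ge0 // -mulrA; apply: bnormM_le; first exact: lexx.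
    exact: bnormM.
  have h2 : normc ((p' +i* q')%C - (p +i* q)%C) <= 2 * (4 * (K + 1))^-1.
    apply: le_trans (normc_le_Re_Im _) _ => /=.
    by rewrite distrC (distrC q'); lra.
  have h3 : 2 * (4 * (K + 1))^-1 * K <= 2^-1.
    have -> : 2 * (4 * (K + 1))^-1 = 2^-1 / (K + 1) by field; lra.
    by rewrite -mulrA ler_piMr ?invr_ge0 // mulrC ler_pdivrMr; lra.
  have G0 : 0 <= G by exact: bnorm_ge0.
  have h4 : normc ((p' +i* q')%C - (p +i* q)%C) * K <= 2^-1.
    by apply: le_trans h3; apply: ler_wpM2r.
  have : normc ((p' +i* q')%C - (p +i* q)%C) * K * G <= 2^-1 * G by apply: ler_wpM2r.
  by move: h1; rewrite (mulrC G) mulrA; lra.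
exists M => z zr; have [h1 h2] := Re_Im_le_normc z.
by case: z zr h1 h2 => p q zr h1 h2; apply: HM; apply: le_trans zr.
Qed.

Lemma root_minus1 m : exists2 z : R[i], z ^+ (2 ^ m) = -1 & normc z = 1.
Proof.
have [z zm] : exists z : R[i], z ^+ (2 ^ m) = -1.
  elim: m => [|m [z zm]]; first by exists (-1).
  by exists (sqrtc z); rewrite expnS exprM sqr_sqrtc.
exists z => //; apply/eqP; rewrite -(@pexpr_eq1 _ _ (2 ^ m)) ?expn_gt0 ?normc_ge0 //.
by rewrite -normcX zm normcN Normc.normc1.
Qed.

Lemma root_minus1_expZ m z x : z ^+ (2 ^ m) = -1 ->
  ((z : R[i]) *: x) ^+ (2 ^ m) = - x ^+ (2 ^ m).
Proof. by move=> zm; rewrite exprZn zm scaleN1r. Qed.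

(** 1 - w^2 = (1 - w)(1 + w), and 1 + w is the same expression as 1 - w at the rotated point
    [t * z], where t^(2^m) = -1. *)
Lemma unitB_dyadic m z : 1 - (z *: y) ^+ (2 ^ m) \is a GRing.unit.
Proof.
elim: m z => [|m IH] z; first by rewrite expn0 expr1.
have [t tm _] := root_minus1 m.
have := IH (t * z); rewrite -scalerA root_minus1_expZ // opprK => ut.
set w := (z *: y) ^+ (2 ^ m) in ut *.
have -> : 1 - (z *: y) ^+ (2 ^ m.+1) = (1 - w) * (1 + w).
  by rewrite expnSr exprM -/w expr2 mulrBl !mulrDr !mul1r mulr1 opprD addrA addrK.
by rewrite unitrMl // IH.
Qed.

Definition dyadic_resolvent m z := (1 - (z *: y) ^+ (2 ^ m))^-1.

(** Partial fractions: 1/(1 - w^2) is the mean of 1/(1 - w) and 1/(1 + w). *)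
Lemma dyadic_resolventS m z t : t ^+ (2 ^ m) = -1 ->
  dyadic_resolvent m.+1 z =
  2^-1 *: (dyadic_resolvent m z + dyadic_resolvent m (t * z)).
Proof.
move=> tm; have := unitB_dyadic m (t * z).
rewrite /dyadic_resolvent -scalerA root_minus1_expZ // opprK.
have := unitB_dyadic m z.
set w := (z *: y) ^+ (2 ^ m) => um up.
have -> : 1 - (z *: y) ^+ (2 ^ m.+1) = (1 + w) * (1 - w).
  by rewrite expnSr exprM -/w expr2 mulrBr !mulr1 mulrDl mul1r opprD addrA addrK.
have -> : (1 - w)^-1 + (1 + w)^-1 = (1 - w)^-1 * (1 + w + (1 - w)) / (1 + w).
  by rewrite mulrDr mulVr // mulrDl mulrK // mul1r.
have -> : 1 + w + (1 - w) = (2 : R[i])%:A by rewrite addrACA subrr addr0 scaler_nat.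
by rewrite invrM // mulr_algr -scalerAl scalerA mulVf ?pnatr_eq0 // scale1r.
Qed.

Lemma dyadic_resolvent_lipschitz r : exists2 L : R, 0 <= L & forall m z z',
  normc z <= r -> normc z' <= r ->
  nrm (dyadic_resolvent m z - dyadic_resolvent m z') <= L * normc (z - z').
Proof.
have [M HM] := resolvent_bounded r.
exists (`|M| * nrm y * `|M|); first by rewrite !mulr_ge0 ?bnorm_ge0.
elim=> [|m IH] z z' hz hz'.
  have E s : dyadic_resolvent 0 s = resolvent y s.
    by rewrite /dyadic_resolvent expn0 expr1.
  rewrite !E resolventB bnormZ mulrC ler_wpM2r ?normc_ge0 //.
  have HM' s : normc s <= r -> nrm (resolvent y s) <= `|M|.
    by move=> hx; apply: le_trans (HM _ hx) (ler_norm _).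
  by apply: bnormM_le; [apply: bnormM_le => //|]; apply: HM'.
have [t tm t1] := root_minus1 m.
rewrite !(dyadic_resolventS _ tm) -scalerBr bnormZ normc_half opprD addrACA.
have ht s : normc (t * s) = normc s by rewrite Normc.normcM t1 mul1r.
have := IH _ _ hz hz'; have := IH (t * z) (t * z'); rewrite !ht -mulrBr ht => /(_ hz hz').
set K := _ * normc _ => h1 h2.
have := bnormD N (dyadic_resolvent m z - dyadic_resolvent m z')
  (dyadic_resolvent m (t * z) - dyadic_resolvent m (t * z')).
lra.
Qed.

(** One exponent for each [e] is enough, as repeated squaring shrinks any norm that is at most
    1/2. *)
Definition power_vanishing r := forall e, 0 < e ->
  exists m, nrm ((r%:C%C *: y) ^+ (2 ^ m)) < e.

Lemma power_vanishing_of_half r m :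
  nrm ((r%:C%C *: y) ^+ (2 ^ m)) <= 2^-1 -> power_vanishing r.
Proof.
move=> H e e0.
have key j : nrm ((r%:C%C *: y) ^+ (2 ^ (m + j))) <= 2^-1 ^+ j.+1.
  elim: j => [|j IH]; first by rewrite addn0 expr1.
  rewrite addnS expnSr exprM expr2; apply: le_trans (bnormM_le IH IH) _.
  rewrite [X in _ <= X]exprSr ler_wpM2l ?half_exp_ge0 //.
  by rewrite exprS ler_piMr ?invr_ge0 // exprn_ile1 ?invr_ge0 // invf_le1 // ler1n.
have [n0 Hn] := half_exp_small 1 e0.
exists (m + n0)%N; apply: le_lt_trans (key n0) _.
by have := Hn n0.+1 (leqnSn _); rewrite mul1r.
Qed.

(** d = (1 - w)^-1 - 1 satisfies d = w + d w, so |w| < 1/10 gives |d| <= 1/9. Then |d'| <= 1/9 +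
    1/10 = 19/90, and w' = d' - d' w' yields |w'| <= 19/71 < 1/2. *)
Lemma power_vanishing_step r r' m :
  nrm ((r%:C%C *: y) ^+ (2 ^ m)) < 10^-1 ->
  nrm (dyadic_resolvent m r'%:C%C - dyadic_resolvent m r%:C%C) <= 10^-1 ->
  nrm ((r'%:C%C *: y) ^+ (2 ^ m)) <= 2^-1.
Proof.
rewrite /dyadic_resolvent.
have u1 := unitB_dyadic m r%:C%C; have u2 := unitB_dyadic m r'%:C%C.
move: u1 u2; set w := _ ^+ (2 ^ m); set w' := (r'%:C%C *: y) ^+ (2 ^ m) => u1 u2 h1 h2.
have E x : 1 - x \is a GRing.unit -> (1 - x)^-1 - 1 = x + ((1 - x)^-1 - 1) * x.
  move=> ux; rewrite [in RHS]mulrBl mul1r [RHS]addrC subrK.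
  by rewrite -[X in _ - X = _](mulVr ux) mulrBr mulr1 subKr.
set d := (1 - w)^-1 - 1; set d' := (1 - w')^-1 - 1.
have dw : nrm d <= nrm w + nrm d * nrm w.
  by rewrite {1}/d E //; apply: le_trans (bnormD N _ _) _; rewrite lerD2l bnormM.
have dw' : nrm w' <= nrm d' + nrm d' * nrm w'.
  have {1}-> : w' = d' - d' * w' by rewrite {1}/d' E // addrK.
  by apply: le_trans (bnormB N _ _) _; rewrite lerD2l bnormM.
have dd : nrm d' <= nrm d + 10^-1.
  have -> : d' = d + ((1 - w')^-1 - (1 - w)^-1) by rewrite /d addrC addrA subrK.
  by apply: le_trans (bnormD N _ _) _; rewrite lerD2l.
have := bnorm_ge0 N d; have := bnorm_ge0 N w'; have := bnorm_ge0 N w; have := bnorm_ge0 N d'.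
have d9 : nrm d <= 9^-1 by nra.
nra.
Qed.

Lemma power_vanishing_all r : 0 <= r -> power_vanishing r.
Proof.
move=> r0; have [L L0 HL] := dyadic_resolvent_lipschitz r.
(* The interval [0, r] is cut into [K] pieces on each of which the Lipschitz bound allows a change
   of at most 1/10; the successor makes [K] positive. *)
pose K := (Num.bound (10 * L * r)).+1.
have HK : 10 * L * r <= K%:R.
  apply: ltW; apply: (@lt_trans _ _ (Num.bound (10 * L * r))%:R); last by rewrite ltr_nat.
  by apply: archi_boundP; rewrite !mulr_ge0.
have K0 : 0 < K%:R :> R by rewrite ltr0n.
have normcR q : 0 <= q -> normc q%:C%C = q.
  by move=> q0; rewrite /= expr0n /= addr0 sqrtr_sqr ger0_norm.
have rj j : (j <= K)%N -> 0 <= j%:R / K%:R * r <= r.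
  move=> jK; rewrite !mulr_ge0 ?invr_ge0 ?ler0n //=.
  by rewrite ler_piMl // ler_pdivrMr // mul1r ler_nat.
suff H j : (j <= K)%N -> power_vanishing (j%:R / K%:R * r).
  by have := H K (leqnn _); rewrite divff ?gt_eqF // mul1r.
elim: j => [|j IH] jK.
  move=> e e0; exists 0%N; rewrite !mul0r scale0r expn0 expr1 bnorm0 //.
have t10 : 0 < 10^-1 :> R by rewrite invr_gt0.
have [m hm] := IH (ltnW jK) _ t10.
apply: (@power_vanishing_of_half _ m); apply: power_vanishing_step hm _.
have /andP[a0 a1] := rj _ jK; have /andP[b0 b1] := rj _ (ltnW jK).
apply: le_trans (HL _ _ _ _ _) _; rewrite ?normcR //.
rewrite -rmorphB -mulrBl -mulrBl -natrB ?leqnSn // subSnn normcR ?mulr_ge0 ?invr_ge0 ?ler0n //.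
rewrite mulrCA mul1r ler_pdivrMl //.
lra.
Qed.

(** At radius 1/e some (y/e)^(2^m) has norm below 1, and this single power controls all others by
    [power_bound]. *)
Lemma topnil_of_entire_resolvent : topnil N y.
Proof.
move=> e e0; have ei : 0 <= e^-1 by rewrite invr_ge0 ltW.
have [m] := power_vanishing_all ei ltr01.
rewrite exprZn bnormZ => h.
apply: (@power_bound _ _ N y e (2 ^ m)) => //; first by rewrite expn_gt0.
move: h; rewrite normcX /= expr0n /= addr0 sqrtr_sqr ger0_norm // exprVn.
by rewrite ltr_pdivrMl ?exprn_gt0 // mulr1 => /ltW.
Qed.
End EntireResolvent.

Lemma quasinilpotentP y : quasinilpotent y <-> topnil N y.
Proof.
split=> [qy|]; last exact: topnil_quasinilpotent.
apply: topnil_of_entire_resolvent => z.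
have [->|z0] := eqVneq z 0; first by rewrite scale0r subr0 unitr1.
have -> : 1 - z *: y = z *: (z^-1%:A - y) by rewrite scalerBr scalerA divff // scale1r.
rewrite scaler_unit ?unitfE //; apply: contraT => nu.
by have /eqP := (qy z^-1).1 nu; rewrite invr_eq0 (negPf z0).
Qed.
End Quasinilpotent.

(** * Generalized pi-Hirano inverses *)

Section GpiHirano.
Set Implicit Arguments.
Unset Strict Implicit.
Unset Printing Implicit Defensive.
Variables (R : realType) (A : unitAlgType R[i]) (N : banach_norm A).
Implicit Types (a c d u v x y : A).
Local Notation nrm := (bnorm N).

(** With f = 1 - a x one has x f = 0, hence y f = a f and a - a^(n+1) = y (1 - a^n f), a product of
    commuting factors. *)
Lemma gpi_Hirano_topnil a : gpi_Hirano_invertible a ->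
  exists2 n, (0 < n)%N & topnil N (a - a ^+ n.+1).
Proof.
case=> x [xax ax [n [n0 /(quasinilpotentP N) ty]]]; exists n => //.
set y := a - _ in ty; pose f := 1 - a * x.
have xf : x * f = 0 by rewrite mulrBr mulr1 mulrA xax subrr.
have af : GRing.comm a f.
  by apply: commrB; [exact: commr1|apply: commrM].
have ay : GRing.comm a y.
  by apply: commrB => //; apply: commrM => //; apply: commrX.
have yf : y * f = a * f by rewrite mulrBl -[_ * x * f]mulrA xf mulr0 subr0.
have yaf : GRing.comm y (a ^+ n * f).
  apply: commrM; first by apply: commrX; apply/commr_sym.
  apply: commrB; first exact: commr1.
  apply: commrM; first exact/commr_sym.
  apply/commr_sym/commrB; first exact/commr_sym.
  by apply: commrM => //; apply: commrX; apply/commr_sym.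
have -> : a - a ^+ n.+1 = y * (1 - a ^+ n * f).
  rewrite mulrBr mulr1 mulrA (commrX n (commr_sym ay)) -mulrA yf mulrA -exprSr.
  by rewrite mulrBr mulr1 mulrA -exprSr /y addn2 opprB addrA subrK.
by apply: topnilM => //; apply: commrB => //; exact: commr1.
Qed.

Lemma topnil_gpi_Hirano a n : (0 < n)%N -> topnil N (a - a ^+ n.+1) ->
  gpi_Hirano_invertible a.
Proof.
case: n => // m _; set p := a - _ => tp; pose c := a ^+ m.+1.
have ap : GRing.comm a p by apply: commrB => //; apply: commrX.
have ac : GRing.comm a c by apply: commrX.
have cp : c - c * c = p * a ^+ m.
  by rewrite /p mulrBl -exprS; congr (_ - _); rewrite -!exprD addSn addnS.
have pam : GRing.comm p (a ^+ m) by apply: commrX; apply: commr_sym.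
have [|e [d [ee ce cent]]] := @lift_idempotent _ _ N c.
  by rewrite cp; apply: topnilM.
have [ae ad] := cent _ ac.
have [cce ccd] := cent c erefl.
have ccp : GRing.comm c p by apply/commr_sym; apply: commrX; apply/commr_sym.
have [pe pd] := cent p (commr_sym ccp).
have ed : GRing.comm e d by have [_] := cent e (commr_sym cce).
(* Since e u = e c = a^(m+1) e, the element x = a^m e u^-1 satisfies a x = e. *)
pose u := 1 - e * (e - c).
have uu : u \is a GRing.unit.
  apply: (topnil_unit (N := N)).
  have -> : e * (e - c) = p * (a ^+ m * (- (d * e))).
    rewrite -(opprB c e) ce cp !mulrN; congr (- _).
    have eam : GRing.comm e (a ^+ m) by apply: commrX; apply/commr_sym.
    by rewrite !mulrA -pe -!mulrA (mulrA e (a ^+ m)) eam -mulrA ed !mulrA.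
  apply: topnilM => //; apply: commrM => //; apply: commrN.
  exact: commrM.
have au : GRing.comm a u.
  by apply: commrB; [exact: commr1|apply: commrM => //; apply: commrB].
have eu : GRing.comm e u.
  apply: commrB; [exact: commr1|apply: commrM => //; apply: commrB => //].
have auV : GRing.comm a u^-1 by apply: commrV.
have euV : GRing.comm e u^-1 by apply: commrV.
exists (a ^+ m * e * u^-1).
have axe : a * (a ^+ m * e * u^-1) = e.
  rewrite !mulrA -exprS -/c; apply: (mulIr uu); rewrite mulrVK //.
  by rewrite mulrBr mulr1 mulrA ee mulrBr ee subKr.
have ax : GRing.comm a (a ^+ m * e * u^-1).
  by apply: commrM => //; apply: commrM => //; apply: commrX.
split => //.
  by rewrite -mulrA axe -(mulrA _ u^-1) -euV mulrA -[_ * e * e]mulrA ee.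
exists m.+1; split => //; apply/(quasinilpotentP N).
have -> : (m.+1 + 2 = m.+2.+1)%N by rewrite addn2.
rewrite exprSr -mulrA axe.
(* c (1 - e) = (c - e)(1 - e) is a multiple of [p], and a - a^(m+2) e = p + a c (1 - e). *)
have -> : a - a ^+ m.+2 * e = p * (1 + a ^+ m.+1 * (d * (1 - e))).
  have h : c * (1 - e) = p * a ^+ m * d * (1 - e).
    rewrite -cp -ce !mulrBl !mulrBr !mulr1 ee subrr subr0; congr (_ - _).
  rewrite mulrDr mulr1; have -> : p * (a ^+ m.+1 * (d * (1 - e))) = a * (c * (1 - e)).
    by rewrite h exprS !mulrA -ap.
  by rewrite mulrBr mulr1 mulrBr mulrA -exprS addrA subrK.
apply: topnilM => //; apply: commrD; first exact: commr1.
apply: commrM; first by apply: commrX; apply/commr_sym.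
by apply: commrM => //; apply: commrB => //; exact: commr1.
Qed.

(** Factorisation by a geometric sum; it lets two elements with different exponents share a common
    multiple. *)
Lemma topnil_subX_mul a n q : topnil N (a - a ^+ n.+1) -> topnil N (a - a ^+ (n * q).+1).
Proof.
move=> ta.
have -> : a - a ^+ (n * q).+1 = (a - a ^+ n.+1) * \sum_(i < q) (a ^+ n) ^+ i.
  have E j : a - a ^+ j.+1 = - (a * (a ^+ j - 1)) by rewrite mulrBr mulr1 -exprS opprB.
  by rewrite !E mulNr -mulrA -subrX1 -exprM.
apply: topnilM => //; apply: commr_sum => i _; apply: commrX; apply: commrX.
by apply/commr_sym/commrB => //; apply: commrX.
Qed.

Lemma topnil_eventually p v j x y : topnil N p ->
  (forall n, v ^+ (n + j) = x * p ^+ n * y) -> topnil N v.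
Proof.
move=> tp E e e0; have [C HC] := tp e e0.
apply: (exp_bound_eventually (j := j) (C := nrm x * C * nrm y)) => // n.
  exact: bnorm_ge0.
rewrite E mulrAC; apply: bnormM_le => //; rewrite -mulrA; exact: bnormM_le.
Qed.

(** The solution is v^n x_0 plus n terms v^i c u^(n-1-i) d, each of order h^n for h = e/2; the
    factor n is absorbed by 2^n. *)
Lemma exp_bound_affine_rec u v c d (x : nat -> A) e : topnil N u -> topnil N v ->
  (forall n, x n.+1 = v * x n + c * u ^+ n * d) -> 0 < e ->
  exists C : R, forall n, nrm (x n) <= C * e ^+ n.
Proof.
move=> tu tv xS e0; pose h := e / 2; have h0 : 0 < h by rewrite divr_gt0.
have [C HC] := tu h h0; have [D HD] := tv h h0.
have C0 : 0 <= C by have := HC 0%N; rewrite mulr1; apply: le_trans; exact: bnorm_ge0.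
have D0 : 0 <= D by have := HD 0%N; rewrite mulr1; apply: le_trans; exact: bnorm_ge0.
pose K1 := D * nrm (x 0%N); pose K2 := D * nrm c * C * nrm d / h.
have K10 : 0 <= K1 by rewrite mulr_ge0 ?bnorm_ge0.
have K20 : 0 <= K2 by rewrite divr_ge0 ?(ltW h0) // !mulr_ge0 ?bnorm_ge0.
(* Carrying v^j along leaves powers of [v] to be bounded as a whole, instead of losing a factor |v|
   at each step. *)
have key n j : nrm (v ^+ j * x n) <= h ^+ (j + n) * (K1 + n%:R * K2).
  elim: n j => [|n IH] j.
    by rewrite addn0 mul0r addr0 mulrCA mulrA; apply: bnormM_le.
  rewrite xS mulrDr mulrA -exprSr -natr1 mulrDl mul1r addrA mulrDr.
  apply: le_trans (bnormD N _ _) _; apply: lerD; first by rewrite addnS -addSn.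
  have -> : h ^+ (j + n.+1) * K2 = (D * h ^+ j) * (nrm c * (C * h ^+ n) * nrm d).
    rewrite /K2 addnS exprS exprD; field; rewrite gt_eqF //.
  by apply: bnormM_le => //; do 2!apply: bnormM_le => //.
exists (K1 + K2) => n; have := key n 0%N.
rewrite expr0 mul1r add0n => /le_trans; apply.
have -> : e ^+ n = h ^+ n * 2 ^+ n by rewrite -exprMn divfK ?pnatr_eq0.
rewrite [X in _ <= X]mulrCA; apply: ler_wpM2l; first by rewrite exprn_ge0 ?(ltW h0).
rewrite mulrDl.
have h1 : 1 <= 2 ^+ n :> R by rewrite -natrX (ler_nat _ 1) expn_gt0.
have h2 : n%:R <= 2 ^+ n :> R by rewrite -natrX ler_nat ltnW // ltn_expl.
by apply: lerD; [rewrite ler_peMr|rewrite mulrC ler_wpM2l].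
Qed.
End GpiHirano.

(** * Powers of the sum *)

Section SumAnnihilated.
Set Implicit Arguments.
Unset Strict Implicit.
Unset Printing Implicit Defensive.
Variables (B : nzRingType) (a b : B) (k : nat).
Implicit Types (t u v x : B) (w : seq bool).

Definition word w : B := \prod_(i <- w) (if i then a else b).

Hypothesis abw : forall w, size w = k -> a * b * word w = 0.

(** Allowing words of every length makes the condition stable under left multiplication by [a] and
    [b]. *)
Definition ab_dead t := forall w, a * b * word w * t = 0.
Local Notation s := (a + b).

Lemma ab_deadE t : ab_dead t -> a * (b * t) = 0.
Proof. by move=> /(_ [::]); rewrite /word big_nil mulr1 mulrA. Qed.

Lemma ab_deadMl t : ab_dead t -> ab_dead (a * t) /\ ab_dead (b * t).
Proof.
move=> dt; split=> w; [have := dt (rcons w true)|have := dt (rcons w false)];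
  by rewrite /word big_rcons /= !mulrA.
Qed.

Lemma ab_deadD t x : ab_dead t -> ab_dead x -> ab_dead (t + x).
Proof. by move=> dt dx w; rewrite mulrDr dt dx addr0. Qed.

Lemma ab_deadB t x : ab_dead t -> ab_dead x -> ab_dead (t - x).
Proof. by move=> dt dx w; rewrite mulrBr dt dx subr0. Qed.

Lemma ab_dead_sM t n : ab_dead t -> ab_dead (s ^+ n * t).
Proof.
move=> dt; elim: n => [|n IH]; first by rewrite mul1r.
by rewrite exprS -mulrA mulrDl; have [] := ab_deadMl IH; exact: ab_deadD.
Qed.

Lemma ab_dead_pow x : x \in [:: a; b; s] -> ab_dead (x ^+ k).
Proof.
move=> xin w.
have : (k <= size w + k)%N by rewrite leq_addl.
(* The factors of x^k move one by one into [w]; with [j] left, k <= size w + j. At j = 0 a prefix of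
   [w] of length [k] is killed by [abw]. *)
elim: {2 3}k w => [|j IH] w hw.
  rewrite mulr1 -(cat_take_drop k w) /word big_cat /= mulrA abw ?mul0r //.
  by rewrite size_takel // -(addn0 (size w)).
have Ha : a * b * word w * (a * x ^+ j) = 0.
  by rewrite mulrA -(IH (rcons w true)) ?size_rcons ?addSnnS // /word big_rcons /= !mulrA.
have Hb : a * b * word w * (b * x ^+ j) = 0.
  by rewrite mulrA -(IH (rcons w false)) ?size_rcons ?addSnnS // /word big_rcons /= !mulrA.
rewrite exprS; move: xin; rewrite !inE => /or3P[]/eqP E; rewrite {1}E //.
by rewrite mulrDl mulrDr Ha Hb addr0.
Qed.

Lemma a_sX t n : ab_dead t -> a * (s ^+ n * t) = a ^+ n.+1 * t.
Proof.
elim: n t => [|n IH] t dt; first by rewrite mul1r.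
rewrite exprSr -mulrA IH; last by rewrite -[s]expr1; exact: ab_dead_sM.
have ab0 : a ^+ n.+1 * (b * t) = 0 by rewrite exprSr -mulrA ab_deadE // mulr0.
by rewrite mulrDl mulrDr ab0 addr0 mulrA -exprSr.
Qed.

(** Only the words b^i a^j, free of the factor a b, survive on [t], so [W] is the sum of b^i a^(n-i)
    for i <= n. Its independence of [t] gives the recurrence for p^n t constant coefficients. *)
Lemma sX_decomp n : exists W, forall t, ab_dead t ->
  s ^+ n.+1 * t = b ^+ n.+1 * t + W * (a * t).
Proof.
elim: n => [|n [W HW]]; first by exists 1 => t _; rewrite mul1r mulrDl addrC.
exists (b * W + a ^+ n.+1) => t dt.
rewrite exprS -mulrA [LHS]mulrDl a_sX // HW // mulrDr mulrA -exprS.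
by rewrite mulrDl (mulrA (a ^+ n.+1)) -exprSr -(mulrA b W) [LHS]addrCA [X in _ + X = _]addrC.
Qed.

Variable l : nat.
Local Notation p := (s - s ^+ l.+1).
Local Notation u := (a - a ^+ l.+1).
Local Notation v := (b - b ^+ l.+1).

Lemma ab_dead_pX t n : ab_dead t -> ab_dead (p ^+ n * t).
Proof.
move=> dt; elim: n => [|n IH]; first by rewrite mul1r.
rewrite exprS -mulrA mulrBl; apply: ab_deadB; last exact: ab_dead_sM.
by have := @ab_dead_sM _ 1 IH; rewrite expr1.
Qed.

Lemma comm_subX x n : GRing.comm x (x - x ^+ n).
Proof. by apply: commrB => //; apply: commrX. Qed.

Lemma a_p t : ab_dead t -> a * (p * t) = a * (u * t).
Proof.
move=> dt; rewrite !mulrBl !mulrBr a_sX // -{1}[s]expr1 a_sX //.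
by rewrite !mulrA -exprS -expr2.
Qed.

Lemma a_pX t n : ab_dead t -> a * (p ^+ n * t) = a * (u ^+ n * t).
Proof.
elim: n t => [|n IH] t dt; first by [].
have := @ab_dead_pX _ 1 dt; rewrite expr1 => dpt.
rewrite exprSr -mulrA IH // mulrA (commrX n (comm_subX a l.+1)) -mulrA a_p //.
by rewrite mulrA -(commrX n (comm_subX a l.+1)) -mulrA (mulrA (_ ^+ n)) -exprSr.
Qed.

(** For x = p^n t the decomposition of s^(l+1) gives p x = v x + (1 - W) a x, and a x = a u^n t. *)
Lemma p_rec : exists W, forall t n, ab_dead t ->
  p ^+ n.+1 * t = v * (p ^+ n * t) + W * a * u ^+ n * t.
Proof.
have [W HW] := sX_decomp l; exists (1 - W) => t n dt.
have dx := ab_dead_pX n dt.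
rewrite -!mulrA -a_pX // exprS -mulrA; set x := p ^+ n * t in dx *.
rewrite [LHS]mulrBl HW // [s * x]mulrDl [v * x]mulrBl [(1 - W) * _]mulrBl mul1r.
by rewrite opprD [a * x + _]addrC addrACA.
Qed.

Lemma sub_expM x n : (x - x ^+ l.+1) ^+ n = x ^+ n * (1 - x ^+ l) ^+ n.
Proof.
rewrite -exprMn_comm; first by rewrite mulrBr mulr1 -exprS.
by apply: commrB; [exact: commr1|apply: commrX].
Qed.

(** u^(k+1) contains the factor a^(k+1) = a a^k, and a u^n agrees with a p^n on a^k. *)
Lemma uX_of_pX : exists y, forall n, u ^+ (n + k.+1) = a * p ^+ n * y.
Proof.
exists (a ^+ k * (1 - a ^+ l) ^+ k.+1) => n.
rewrite exprD [_ ^+ k.+1]sub_expM !mulrA; congr (_ * _).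
rewrite -mulrA a_pX; last by apply: ab_dead_pow; rewrite inE eqxx.
by rewrite [RHS]mulrA (commrX n (comm_subX a l.+1)) -[RHS]mulrA -exprS.
Qed.

(** Since a b^(k+1) = 0, [a + b] acts on b^(k+1) as [b] does, and [p] as [v]. *)
Lemma vX_of_pX : exists y, forall n, v ^+ (n + k.+1) = p ^+ n * y.
Proof.
have ab0 : a * b ^+ k.+1 = 0.
  by rewrite exprS ab_deadE //; apply: ab_dead_pow; rewrite !inE eqxx orbT.
have sb n : s ^+ n * b ^+ k.+1 = b ^+ n * b ^+ k.+1.
  elim: n => // n IH; rewrite (exprS s) (exprS b n) -!mulrA IH mulrDl.
  by rewrite -exprD addnC exprD (mulrA a) ab0 mul0r add0r.
have bv : b ^+ k.+1 * v = v * b ^+ k.+1.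
  by apply/esym/commrX/commr_sym/comm_subX.
have pb : p * b ^+ k.+1 = b ^+ k.+1 * v.
  rewrite mulrBl sb -{1}[s]expr1 sb expr1 -mulrBl.
  by rewrite bv.
exists (b ^+ k.+1 * (1 - b ^+ l) ^+ k.+1) => n.
rewrite exprD [_ ^+ k.+1]sub_expM !mulrA; congr (_ * _).
elim: n => [|n IH]; first by rewrite !mul1r.
by rewrite [in RHS]exprSr -mulrA pb mulrA -IH -mulrA bv mulrA -exprSr.
Qed.

Lemma pX_decomp n : p ^+ (n + k) = p ^+ n * s ^+ k * (1 - s ^+ l) ^+ k.
Proof. by rewrite exprD [_ ^+ k]sub_expM mulrA. Qed.
End SumAnnihilated.

(** * The equivalence between the two summands and their sum *)

Theorem theorem3p2 (R : realType) (A : unitAlgType R[i]) (N : banach_norm A)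
  (a b : A) (k : nat) :
  (0 < k)%N ->
  (forall alpha : 'I_k -> A, (forall j, alpha j = a \/ alpha j = b) ->
     a * b * (\prod_(j < k) alpha j) = 0) ->
  (gpi_Hirano_invertible a /\ gpi_Hirano_invertible b) <->
  gpi_Hirano_invertible (a + b).
Proof.
move=> _ H.
have abw w : size w = k -> a * b * word a b w = 0.
  move=> wk; rewrite /word (big_nth true) big_mkord wk; apply: H => j.
  by case: (nth true w j); [left|right].
split=> [[/(gpi_Hirano_topnil N)[n n0 ta] /(gpi_Hirano_topnil N)[m m0 tb]]|].
  (* The recurrence for [a + b] needs one exponent for both summands: the product n m. *)
  have nm0 : (0 < n * m)%N by rewrite muln_gt0 n0.
  have {}ta := topnil_subX_mul m ta; have := topnil_subX_mul n tb.
  rewrite mulnC => {}tb; set l := (n * m)%N in nm0 ta tb *.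
  apply: (topnil_gpi_Hirano nm0) => e e0.
  have [W HW] := p_rec a b l.
  have dead : ab_dead a b ((a + b) ^+ k).
    by apply: ab_dead_pow => //; rewrite !inE eqxx !orbT.
  have [|C HC] := exp_bound_affine_rec
    (x := fun i => (a + b - (a + b) ^+ l.+1) ^+ i * (a + b) ^+ k)
    ta tb _ e0 (c := W * a) (d := (a + b) ^+ k).
    by move=> i; rewrite HW.
  (* This factor completes s^k to p^k, turning the bound on p^i s^k into one on p^(i+k). *)
  set c := (1 - (a + b) ^+ l) ^+ k.
  apply: (exp_bound_eventually (j := k) (C := C * bnorm N c)) => // i.
    exact: bnorm_ge0.
  by rewrite pX_decomp mulrAC; apply: bnormM_le.
move=> /(gpi_Hirano_topnil N)[l l0 ts].
have [x Hx] := uX_of_pX abw l; have [y Hy] := vX_of_pX abw l.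
split; apply: (topnil_gpi_Hirano l0).
  exact: topnil_eventually ts Hx.
by apply: (topnil_eventually (j := k.+1) (x := 1) (y := y) ts) => i; rewrite mul1r.
Qed.
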